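(* Every quadratical quasigroup is right simple and left simple.
   Context: A groupoid is a nonempty set with a binary operation, written as juxtaposition. A groupoid $G$ is right solvable if for all $a,b\in G$ there is a unique $x\in G$ with $ax=b$. It has property A if $(xy)x=(zx)(yz)$ for all $x,y,z\in G$. A quadratical quasigroup is a right solvable groupoid with property A (such a groupoid is known to be a quasigroup). A nonempty subset $I$ of a groupoid $G$ is a right ideal if $ig\in I$, and a left ideal if $gi\in I$, for all $i\in I$, $g\in G$. $G$ is right simple (left simple) if every right ideal (left ideal) $I$ of $G$ satisfies $I=G$. *)

(* Defs.v *)
From mathcomp Require Import all_boot.
From mathcomp Require Import classical_sets.

Set Implicit Arguments.
Unset Strict Implicit.
Unset Printing Implicit Defensive.

Local Open Scope classical_set_scope.
Local Open Scope group_scope.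

(* A groupoid is a magmaType whose carrier is nonempty; magmaType itself allows
   an empty carrier, so nonemptiness is a separate condition. *)
Definition groupoid (G : magmaType) : Prop := inhabited G.

Definition right_solvable (G : magmaType) : Prop :=
  forall a b : G, exists! x : G, a * x = b.

Definition property_A (G : magmaType) : Prop :=
  forall x y z : G, (x * y) * x = (z * x) * (y * z).

Definition quadratical_quasigroup (G : magmaType) : Prop :=
  [/\ groupoid G, right_solvable G & property_A G].

Definition right_ideal (G : magmaType) (I : set G) : Prop :=
  I !=set0 /\ forall i g : G, I i -> I (i * g).

Definition left_ideal (G : magmaType) (I : set G) : Prop :=
  I !=set0 /\ forall i g : G, I i -> I (g * i).

Definition right_simple (G : magmaType) : Prop :=
  forall I : set G, right_ideal I -> I = [set: G].

Definition left_simple (G : magmaType) : Prop :=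
  forall I : set G, left_ideal I -> I = [set: G].

(* Main.v *)
Require Import Defs.
From mathcomp Require Import all_boot.
From mathcomp Require Import classical_sets.

(** Solving [i * x = g] shows that a right ideal containing [i] contains [g].
    For a left ideal containing [i], property A taken at [z = i] gives
    [(x * y) * x = (i * x) * (y * i)]: the right factor [y * i] lies in the
    ideal, hence so does every [(x * y) * x].  By right solvability [x * y] can
    be any element, so every product [w * x] lies in the ideal, and every
    element is such a product.  Solvability on the left is thus bypassed. *)

Theorem corollary1p26 (G : magmaType) (hG : quadratical_quasigroup G) :
  right_simple G /\ left_simple G.
Proof.
have [_ solv propA] := hG.
split=> I [[i Ii] mulI]; apply/seteqP; split=> // g _.
- by have [x [<- _]] := solv i g; apply: mulI.
- have [x [<- _]] := solv i g.
  (* Write the left factor [i] itself as [x * y], to reach [(x * y) * x]. *)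
  have [y [xy _]] := solv x i.
  by rewrite -{1}xy (propA x y i); apply/mulI/mulI.
Qed.
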